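(* Let $A:\mathbb{H}\rightrightarrows\mathbb{H}$ and $B:\mathbb{H}\rightrightarrows\mathbb{H}$ be respectively maximally $\alpha$- and $\beta$-monotone with $\alpha+\beta\ge0$. Suppose that $\gamma,\delta>0$ and $\lambda,\mu\ge1$ satisfy $$1+2\gamma\alpha>0,\qquad\mu\in[2-2\gamma\beta,\,2+2\gamma\alpha],\qquad(\lambda-1)(\mu-1)=1,\qquad\delta=(\lambda-1)\gamma,$$ that $\operatorname{zer}(A+B)\neq\emptyset$, and that $\int_{t_0}^{+\infty}\theta(s)ds=+\infty$. Write $T:=R_{\delta B}^{\mu}R_{\gamma A}^{\lambda}$. Let $u(t)$ be the trajectory (unique strong global solution) of $$\frac{du}{dt}+\theta(t)\,[u(t)-T(u(t))]=f(t),\qquad u(t_0)=u_0\in\mathbb{H}.$$ Then: (i) $\int_{t_0}^{+\infty}\theta(s)\|Tu(s)-u(s)\|^2ds<+\infty$. (ii) $\lim_{t\to+\infty}\|Tu(t)-u(t)\|=0$. (iii) There exists $\hat u\in\operatorname{Fix}(T)$ such that $u(t)$ converges weakly to $\hat u$ as $t\to+\infty$.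
   Context: $\mathbb{H}$ is a real Hilbert space, $I$ its identity operator, $t_0>0$, $\theta:[t_0,+\infty)\to[0,+\infty)$ is locally integrable, and $f:[t_0,+\infty)\to\mathbb{H}$ belongs to $L^1([t_0,+\infty))$. A set-valued operator $A:\mathbb{H}\rightrightarrows\mathbb{H}$ is $\alpha$-monotone ($\alpha\in\mathbb{R}$) if $\langle x-y,u-v\rangle\ge\alpha\|x-y\|^2$ whenever $u\in Ax$, $v\in Ay$; it is maximally $\alpha$-monotone if moreover no $\alpha$-monotone operator has a graph strictly containing that of $A$. $J_{\gamma A}=(I+\gamma A)^{-1}$, $R_{\gamma A}^{\lambda}=(1-\lambda)I+\lambda J_{\gamma A}$, $J_{\delta B}=(I+\delta B)^{-1}$, $R_{\delta B}^{\mu}=(1-\mu)I+\mu J_{\delta B}$; under the hypotheses of the claim these are single-valued with full domain (known). $\operatorname{zer}(A+B)=\{x:0\in Ax+Bx\}$; $\operatorname{Fix}(T)=\{x:Tx=x\}$. A strong global solution is a function $u:[t_0,+\infty)\to\mathbb{H}$ that is absolutely continuous on each interval $[t_0,b]$, $t_0<b<+\infty$, satisfies the differential equation for almost every $t\ge t_0$, and satisfies $u(t_0)=u_0$; it exists and is unique here. *)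

(* Defs.v *)
From HB Require Import structures.
From mathcomp Require Import all_boot all_order all_algebra.
From mathcomp Require Import all_classical all_reals all_analysis.

Set Implicit Arguments.
Unset Strict Implicit.
Unset Printing Implicit Defensive.

Import Order.TTheory GRing.Theory Num.Theory.
Import numFieldNormedType.Exports.
Local Open Scope classical_set_scope.
Local Open Scope ring_scope.

(* A real Hilbert space is given as a complete normed module H over R together
   with an inner product inducing its norm. *)
Definition induces_norm (R : realType) (H : completeNormedModType R)
    (dot : {dot H for idfun}) :=
  forall x : H, dot x x = `|x| ^+ 2.

Section SetValuedOperators.
Context {R : realType} {H : completeNormedModType R}.
Implicit Types A B : H -> set H.

Definition graph A : set (H * H) := [set p | A p.1 p.2].

Definition monotone_op (dot : {dot H for idfun}) (alpha : R) A :=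
  forall x y u v, A x u -> A y v -> alpha * `|x - y| ^+ 2 <= dot (x - y) (u - v).

Definition maximally_monotone (dot : {dot H for idfun}) (alpha : R) A :=
  monotone_op dot alpha A /\
  forall A', monotone_op dot alpha A' -> ~ graph A `<` graph A'.

Definition sum_op A B : H -> set H :=
  fun x => [set w | exists u v, [/\ A x u, B x v & w = u + v]].

Definition zer A : set H := [set x | A x 0].

(* (I + gamma A)^-1 as a set-valued operator: y is a value at x iff
   x \in y + gamma A y. *)
Definition resolvent_op (gamma : R) A : H -> set H :=
  fun x => [set y | exists2 v, A y v & x = y + gamma *: v].

(* The single-valued J_{gamma A}; [get] picks the value of [resolvent_op], with
   a default where there is none. For A maximally alpha-monotone and
   1 + gamma alpha > 0 there is exactly one value at every point. *)
Definition resolvent (gamma : R) A : H -> H :=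
  fun x => get (resolvent_op gamma A x).

Definition relaxed_resolvent (gamma : R) A (lambda : R) : H -> H :=
  fun x => (1 - lambda) *: x + lambda *: resolvent gamma A x.

Definition fixpoints (T : H -> H) : set H := [set x | T x = x].

Definition weakly_cvg_at_infty (dot : {dot H for idfun}) (u : R -> H) (l : H) :=
  forall y : H, dot (u t) y @[t --> +oo] --> dot l y.

End SetValuedOperators.

Section Bochner.
Context {R : realType} {V : normedModType R}.
Local Notation leb := (@lebesgue_measure R).
Implicit Types (D : set R) (g : R -> V).

Definition simple_function g :=
  finite_set (range g) /\ forall y, measurable (g @^-1` [set y]).

(* The measurable sets of [leb] are the Borel sets, but since the limit is only
   required almost everywhere, this is strong measurability with respect to the
   Lebesgue sigma-algebra. *)
Definition strongly_measurable D g :=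
  exists2 s : nat -> R -> V, (forall n, simple_function (s n)) &
    {ae leb, forall t, D t -> s n t @[n --> \oo] --> g t}.

(* For a nonnegative function the library integral is the supremum of the
   integrals of the Borel simple functions below it, which is the Lebesgue
   integral also if the function is only Lebesgue measurable. *)
Definition bochner_integrable D g :=
  strongly_measurable D g /\ (\int[leb]_(t in D) `|g t|%:E < +oo)%E.

Definition locally_integrable_from (t0 : R) g :=
  forall b, t0 < b -> bochner_integrable `[t0, b] g.

Definition absolutely_continuous (a b : R) g :=
  forall e : R, 0 < e -> exists2 d : R, 0 < d &
    forall (n : nat) (x y : 'I_n -> R),
      (forall i, a <= x i /\ x i <= y i /\ y i <= b) ->
      trivIset [set: 'I_n] (fun i => `]x i, y i[%classic) ->
      \sum_(i < n) (y i - x i) < d ->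
      \sum_(i < n) `|g (y i) - g (x i)| < e.

(* du/dt + theta(t) [u(t) - T(u(t))] = f(t), u(t0) = u0. Functions on
   [t0, +oo[ are represented by total functions on R; their values before t0
   are irrelevant, as the two-sided derivative sees them only at t = t0. *)
Definition strong_global_solution (t0 : R) (theta : R -> R) (f : R -> V)
    (T : V -> V) (u0 : V) (u : R -> V) :=
  [/\ forall b, t0 < b -> absolutely_continuous t0 b u,
      {ae leb, forall t, t0 <= t ->
         derivable u t 1 /\ 'D_1 u t + theta t *: (u t - T (u t)) = f t}
    & u t0 = u0].

End Bochner.

(* Main.v *)
(** T is nonexpansive: Minty's theorem makes the resolvents single-valued and
    total, and with kappa = mu - 1 = gamma / delta the gap between |x - y|^2 and
    |Tx - Ty|^2 is (1 + kappa) times an expression that the two monotonicity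
    inequalities and the range of mu make nonnegative. Along the trajectory the
    distance to a fixed point z, the residual r = |Tu - u| and |u - z|^2 have
    one-sided difference quotients bounded almost everywhere by |f|, 2|f| and
    - theta r^2 + 2 |u - z| |f|; as they are absolutely continuous, these bounds
    integrate, without differentiating Tu or using the measurability of theta.
    The third bound gives (i), and with the second and the divergence of the
    integral of theta it gives (ii). For (iii), weak cluster points of u along
    ultrafilters are fixed points by demiclosedness of I - T, and Opial's
    argument shows that there is only one. *)

Require Import Defs.
From HB Require Import structures.
From mathcomp Require Import all_boot all_order all_algebra.
From mathcomp Require Import all_classical all_reals all_analysis.
From mathcomp Require Import measurable_realfun.
From mathcomp Require Import ring lra.

Set Implicit Arguments.
Unset Strict Implicit.
Unset Printing Implicit Defensive.

Import Order.TTheory GRing.Theory Num.Theory.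
Import numFieldNormedType.Exports.
Local Open Scope classical_set_scope.
Local Open Scope ring_scope.

(** * Minty's theorem and nonexpansiveness *)

Section InnerProduct.
Context {R : realType} {H : completeNormedModType R}.
Variables (dot : {dot H for idfun}) (hdot : induces_norm dot).
Implicit Types x y z : H.

Lemma dotC x y : dot x y = dot y x.
Proof. by rewrite hermC expr0 mul1r. Qed.

Lemma dotDl x y z : dot (x + y) z = dot x z + dot y z.
Proof. exact: linearDl. Qed.

Lemma dotDr x y z : dot z (x + y) = dot z x + dot z y.
Proof. exact: linearDr. Qed.

Lemma dotNl x z : dot (- x) z = - dot x z.
Proof. exact: linearNl. Qed.

Lemma dotNr x z : dot z (- x) = - dot z x.
Proof. exact: linearNr. Qed.

Lemma dotZl a x z : dot (a *: x) z = a * dot x z.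
Proof. exact: linearZl_LR. Qed.

Lemma dotZr a x z : dot z (a *: x) = a * dot z x.
Proof. by rewrite dotC dotZl dotC. Qed.

Lemma dot0l z : dot 0 z = 0.
Proof. by rewrite -(scale0r (0 : H)) dotZl mul0r. Qed.

Definition dotE := (dotDl, dotDr, dotNl, dotNr, dotZl, dotZr).

Lemma dot_ge0 x : 0 <= dot x x.
Proof. by rewrite hdot exprn_ge0. Qed.

Lemma cauchy_schwarz x y : `|dot x y| <= `|x| * `|y|.
Proof.
have [->|y0] := eqVneq y 0.
  by rewrite dotC dot0l !normr0 mulr0.
have yy : 0 < `|y| ^+ 2 by rewrite exprn_gt0 ?normr_gt0.
rewrite -ler_sqr ?nnegrE ?mulr_ge0// real_normK ?num_real// exprMn.
(* The squared norm of this vector is |y|^2 times the gap |x|^2 |y|^2 - <x, y>^2. *)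
have := dot_ge0 (`|y| ^+ 2 *: x - dot x y *: y).
rewrite !dotE (dotC y x) !hdot => h.
rewrite -subr_ge0 -(pmulr_rge0 _ yy); apply: le_trans h _.
by rewrite le_eqVlt; apply/orP; left; apply/eqP; ring.
Qed.

Lemma dot_ge_small x y (t : R) : `|x| <= t -> - (t * `|y|) <= dot x y.
Proof.
move=> xt; apply: lerNnormlW; apply: le_trans (cauchy_schwarz _ _) _.
by rewrite ler_wpM2r.
Qed.

(** Passage to the limit t -> 0 in a first-order estimate; the cap t <= 1 lets t serve as a convex
    coefficient. *)
Lemma le_of_small (a b c : R) :
  (forall t, 0 < t -> t <= 1 -> a <= b + t * c) -> a <= b.
Proof.
move=> h; apply/ler_addgt0Pr => e e0.
have c0 : 0 < `|c| + 1 by rewrite ltr_wpDl.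
pose t := Num.min 1 (e / (`|c| + 1)).
have t0 : 0 < t by rewrite lt_min ltr01 divr_gt0.
have t1 : t <= 1 by rewrite ge_min lexx.
apply: le_trans (h t t0 t1) _; rewrite lerD2l.
apply: (@le_trans _ _ (t * (`|c| + 1))).
  by rewrite ler_wpM2l ?(ltW t0)// ler_wpDr// ler_norm.
by rewrite -ler_pdivlMr// ge_min lexx orbT.
Qed.

(** The sets [S e] form the base of a Cauchy filter, so completeness supplies the limit. With
    near-minimisers of a strongly convex function as [S e], the limit is the candidate minimiser. *)
Lemma shrinking_sets_limit (S : R -> set H) (K : R) :
  (forall e, 0 < e -> S e !=set0) ->
  (forall e e', e <= e' -> S e `<=` S e') ->
  (forall e x y, 0 < e -> S e x -> S e y -> `|x - y| ^+ 2 <= K * e) ->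
  exists x0, forall e x, 0 < e -> S e x -> `|x - x0| ^+ 2 <= K * e.
Proof.
move=> S0 Smono Sdiam.
pose F := filter_from [set e : R | 0 < e] S.
have FF : ProperFilter F.
  apply: filter_from_proper; last by move=> e /S0.
  apply: filter_from_filter; first by exists 1; rewrite /= ltr01.
  move=> i j /= i0 j0; exists (Num.min i j); first by rewrite /= lt_min i0.
  by move=> x Sx; split; apply: Smono Sx; rewrite ge_min lexx ?orbT.
have K0 : 0 < `|K| + 1 by rewrite ltr_wpDl.
have FC : cvg F.
  apply: cauchy_cvg; apply: cauchy_exP => e /= e0.
  pose d := e ^+ 2 / (2 * (`|K| + 1)).
  have d0 : 0 < d by rewrite divr_gt0 ?exprn_gt0 ?mulr_gt0.
  have [x Sx] := S0 d d0; exists x, d => // y Sy.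
  rewrite -ball_normE /= -ltr_sqr ?nnegrE ?normr_ge0 ?(ltW e0)//.
  apply: le_lt_trans (Sdiam d x y d0 Sx Sy) _.
  apply: (@le_lt_trans _ _ ((`|K| + 1) * d)).
    by rewrite ler_wpM2r ?(ltW d0)// ler_wpDr// ler_norm.
  have -> : (`|K| + 1) * d = e ^+ 2 / 2 by rewrite /d; field; rewrite gt_eqF.
  by rewrite ltr_pdivrMr// ltr_pMr ?exprn_gt0// ltr1n.
exists (lim F) => e x e0 Sx.
have c : `|x - y| ^+ 2 @[y --> F] --> `|x - lim F| ^+ 2.
  by apply: cvgM; apply: cvg_norm; apply: cvgB => //; exact: cvg_cst.
apply: (cvgr_to_le c); exists e => // y Sy; exact: Sdiam.
Qed.

(* Minimises the strongly convex function z |-> phi z + |z|^2 / 2 on H * H,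
   where phi is the Fitzpatrick function of G with epigraph E; the optimality
   condition at a minimiser (x0, y0) says that (- y0, - x0) is monotonically
   related to G, and forces y0 = - x0. *)
Lemma minty (G : H -> H -> Prop) :
  (exists a b, G a b) ->
  (forall a b a' b', G a b -> G a' b' -> 0 <= dot (a - a') (b - b')) ->
  (forall p q, (forall a b, G a b -> 0 <= dot (p - a) (q - b)) -> G p q) ->
  exists y, G y (- y).
Proof.
move=> [a0 [b0 G0]] Gmono Gmax.
pose E x y s := forall a b, G a b -> dot x b + dot a y - dot a b <= s.
pose val x y s := s + (dot x x + dot y y) / 2.
have EG a b : G a b -> E a b (dot a b).
  move=> Gab a' b' Gab'; have := Gmono _ _ _ _ Gab Gab'.
  rewrite !dotE; lra.
(* Fitzpatrick's inequality: if s < <x, y>, then (x, y) is monotonically related to G, hence lies in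
   it, and testing [E] at (x, y) itself gives <x, y> <= s. *)
have Elb x y s : E x y s -> dot x y <= s.
  move=> Es; rewrite leNgt; apply/negP => sxy.
  have Gxy : G x y.
    apply: Gmax => a b /Es; rewrite !dotE; lra.
  have := Es _ _ Gxy; lra.
have val0 x y s : E x y s -> 0 <= val x y s.
  move=> /Elb; have := dot_ge0 (x + y); rewrite /val !dotE (dotC y x); lra.
pose V := [set v | exists x y s, E x y s /\ v = val x y s].
have Vlb : has_lbound V by exists 0 => _ [x [y [s [Es ->]]]]; exact: val0.
have V0 : V !=set0.
  exists (val a0 b0 (dot a0 b0)), a0, b0, (dot a0 b0).
  by split => //; exact: EG.
set m := inf V.
have mle x y s : E x y s -> m <= val x y s.
  by move=> Es; apply: ge_inf => //; exists x, y, s.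
have near_min e : 0 < e -> exists x y s, E x y s /\ val x y s < m + e.
  move=> e0; have [_ [x [y [s [Es ->]]]] lt] := inf_adherent e0 (conj V0 Vlb).
  by exists x, y, s.
have Econv x y s a b r t : 0 <= t -> t <= 1 -> E x y s -> E a b r ->
    E (x + t *: (a - x)) (y + t *: (b - y)) (s + t * (r - s)).
  move=> t0 t1 Es Er p q Gpq; have := Es _ _ Gpq; have := Er _ _ Gpq.
  rewrite !dotE => h1 h2; nra.
(* The midpoint has value at least m, while the parallelogram identity puts it (|x - x'|^2 + |y -
   y'|^2) / 8 below the mean of the two values. *)
have diam e x y s x' y' s' : 0 < e -> E x y s -> val x y s < m + e ->
    E x' y' s' -> val x' y' s' < m + e ->
    `|x - x'| ^+ 2 <= 8 * e /\ `|y - y'| ^+ 2 <= 8 * e.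
  move=> e0 Es vs Es' vs'; rewrite -!hdot.
  have h0 : (0 : R) <= 2^-1 by lra.
  have h1 : (2^-1 : R) <= 1 by lra.
  have := mle _ _ _ (Econv _ _ _ _ _ _ _ h0 h1 Es Es').
  have := dot_ge0 (x - x'); have := dot_ge0 (y - y').
  move: vs vs'; rewrite /val !dotE (dotC x' x) (dotC y' y) => v1 v2 v3 v4 v5.
  split; lra.
have [x0 hx0] : exists x0, forall e x, 0 < e ->
    (exists y s, E x y s /\ val x y s < m + e) -> `|x - x0| ^+ 2 <= 8 * e.
  apply: (@shrinking_sets_limit
    (fun e => [set x | exists y s, E x y s /\ val x y s < m + e]) 8).
  - by move=> e /near_min [x [y [s h]]]; exists x, y, s.
  - move=> e e' ee x /= [y [s [Es vs]]]; exists y, s; split => //.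
    by apply: lt_le_trans vs _; rewrite lerD2l.
  - move=> e x x' e0 [y [s [Es vs]]] [y' [s' [Es' vs']]].
    exact: (diam e x y s x' y' s' e0 Es vs Es' vs').1.
have [y0 hy0] : exists y0, forall e y, 0 < e ->
    (exists x s, E x y s /\ val x y s < m + e) -> `|y - y0| ^+ 2 <= 8 * e.
  apply: (@shrinking_sets_limit
    (fun e => [set y | exists x s, E x y s /\ val x y s < m + e]) 8).
  - by move=> e /near_min [x [y [s h]]]; exists y, x, s.
  - move=> e e' ee y /= [x [s [Es vs]]]; exists x, s; split => //.
    by apply: lt_le_trans vs _; rewrite lerD2l.
  - move=> e y y' e0 [x [s [Es vs]]] [x' [s' [Es' vs']]].
    exact: (diam e x y s x' y' s' e0 Es vs Es' vs').2.
(* The height at which [val] equals m, so that [E0] says that the infimum is attained. *)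
pose s0 := m - (dot x0 x0 + dot y0 y0) / 2.
have E0 : E x0 y0 s0.
  move=> a b Gab; apply: (@le_of_small _ _ (1 + `|b + x0| + `|a + y0|)) => t t0 t1.
  (* With this tolerance the factor 8 of [diam] puts x and y within t of x0 and y0. *)
  have e0 : 0 < t ^+ 2 / 8 by rewrite divr_gt0 ?exprn_gt0.
  have [x [y [s [Es vs]]]] := near_min _ e0.
  have dx : `|x - x0| <= t.
    rewrite -ler_sqr ?nnegrE ?(ltW t0)//.
    have -> : t ^+ 2 = 8 * (t ^+ 2 / 8) by field.
    by apply: hx0 => //; exists y, s.
  have dy : `|y - y0| <= t.
    rewrite -ler_sqr ?nnegrE ?(ltW t0)//.
    have -> : t ^+ 2 = 8 * (t ^+ 2 / 8) by field.
    by apply: hy0 => //; exists x, s.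
  have c1 := dot_ge_small (b + x0) dx; have c2 := dot_ge_small (a + y0) dy.
  have := Es _ _ Gab; have := dot_ge0 (x - x0); have := dot_ge0 (y - y0).
  move: c1 c2 vs; rewrite /s0 /val !dotE (dotC y a) (dotC x0 x) (dotC y0 y) (dotC y0 a).
  have : t ^+ 2 / 8 <= t by rewrite expr2; nra.
  move=> h1 h2 h3 h4 h5 h6 h7; lra.
(* Move from the minimiser towards (a, b, <a, b>) in the epigraph, divide by t and let t tend to 0;
   Fitzpatrick's inequality then replaces [s0] by <x0, y0>. *)
have opt a b : G a b -> dot (x0 + y0) (x0 + y0) <= dot (a + y0) (b + x0).
  move=> Gab.
  apply: (@le_of_small _ _
    ((dot (a - x0) (a - x0) + dot (b - y0) (b - y0)) / 2)) => t t0 t1.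
  have h1 := mle _ _ _ (Econv _ _ _ _ _ _ _ (ltW t0) t1 E0 (EG _ _ Gab)).
  have h2 := Elb _ _ _ E0; rewrite -subr_ge0 in h1; rewrite -subr_ge0 in h2.
  rewrite -subr_ge0 -(pmulr_rge0 _ t0).
  apply: le_trans (addr_ge0 h1 (mulr_ge0 (ltW t0) h2)) _.
  rewrite le_eqVlt; apply/orP; left; apply/eqP.
  rewrite /val /s0 !dotE (dotC a x0) (dotC b y0) (dotC y0 x0); by field.
have G1 : G (- y0) (- x0).
  apply: Gmax => p q Gpq; have := opt _ _ Gpq; have := dot_ge0 (x0 + y0).
  rewrite !dotE (dotC x0 y0); lra.
exists (- y0); suff -> : - - y0 = - x0 by [].
have := opt _ _ G1; rewrite addNr dot0l hdot => h.
have /eqP : `|x0 + y0| ^+ 2 = 0 by apply: le_anti; rewrite h exprn_ge0.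
by rewrite expf_eq0/= normr_eq0 addr_eq0 => /eqP ->; rewrite opprK.
Qed.

(** Adjoining (p, q) to the graph keeps it alpha-monotone, so by maximality the pair cannot be
    new. *)
Lemma maximally_monotone_mem A (alpha : R) p q :
  maximally_monotone dot alpha A ->
  (forall a b, A a b -> alpha * `|p - a| ^+ 2 <= dot (p - a) (q - b)) -> A p q.
Proof.
move=> [Amono Amax] h; apply: contrapT => NA.
apply: (Amax (fun x u => A x u \/ (x = p /\ u = q))); last first.
  split; first by move=> -[x v] /= Axv; left.
  by move=> /(_ (p, q)) /=; apply: contra_not NA => /(_ (or_intror (conj erefl erefl))).
move=> x y v w [Axv|[-> ->]] [Ayw|[-> ->]].
- exact: Amono.
- by rewrite distrC -(opprB p x) -(opprB q v) dotNl dotNr opprK; exact: h.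
- exact: h.
- by rewrite !subrr normr0 expr0n mulr0 dot0l.
Qed.

(** For fixed x, the substitution [val] turns A into a maximal monotone relation, to which [minty]
    applies; [val y (- y)] is (x - y) / gamma. *)
Lemma resolvent_spec A (alpha gamma : R) :
  maximally_monotone dot alpha A -> 0 < gamma -> 0 < 1 + gamma * alpha ->
  forall x, exists2 v, A (resolvent gamma A x) v & x = resolvent gamma A x + gamma *: v.
Proof.
move=> Amax g0 k0 x; set k := 1 + gamma * alpha in k0.
suff [y [v Ayv xyv]] : resolvent_op gamma A x !=set0.
  rewrite /resolvent; case: xgetP => [z _ //|/(_ y)].
  by case; exists v.
pose val y w := alpha *: y + gamma^-1 *: (k *: w + x).
have gN0 : gamma != 0 by rewrite gt_eqF.
have kN0 : k != 0 by rewrite gt_eqF.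
have valK a v : val a (k^-1 *: (gamma *: (v - alpha *: a) - x)) = v.
  by rewrite /val scalerA mulfV// scale1r subrK scalerA mulVf// scale1r addrC subrK.
have valB a b a' b' : dot (a - a') (val a b - val a' b') =
    alpha * `|a - a'| ^+ 2 + gamma^-1 * k * dot (a - a') (b - b').
  by rewrite -hdot /val !dotE; ring.
have gk0 : 0 < gamma^-1 * k by rewrite mulr_gt0 ?invr_gt0.
have [y Gy] : exists y, A y (val y (- y)).
  apply: (@minty (fun y w => A y (val y w))).
  - have [[a [b Aab]]|N] := pselect (exists a b, A a b).
      by exists a, (k^-1 *: (gamma *: (b - alpha *: a) - x)); rewrite valK.
    (* An empty graph cannot be maximal: every pair is vacuously related to it. *)
    exists 0, 0; apply: (maximally_monotone_mem Amax) => a b Aab.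
    by case: N; exists a, b.
  - move=> a b a' b' Gab Gab'; have := Amax.1 _ _ _ _ Gab Gab'.
    by rewrite valB lerDl pmulr_rge0.
  - move=> p q h; apply: (maximally_monotone_mem Amax) => a b Aab.
    rewrite -(valK a b) valB lerDl pmulr_rge0//.
    by apply: h; rewrite valK.
exists y; exists (val y (- y)) => //.
rewrite /val scalerDr !scalerA mulfV// scale1r scalerN /k scalerDl scale1r opprD.
by rewrite (addrC (- y)) -addrA !addNKr.
Qed.

(** Equal sums force v - v' = - (y - y') / gamma, and alpha-monotonicity then gives (1 + gamma
    alpha) |y - y'|^2 <= 0. *)
Lemma resolvent_unique A (alpha gamma : R) y v y' v' :
  monotone_op dot alpha A -> 0 < gamma -> 0 < 1 + gamma * alpha ->
  A y v -> A y' v' -> y + gamma *: v = y' + gamma *: v' -> y = y'.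
Proof.
move=> Amono g0 k0 Ayv Ayv' e.
have := Amono _ _ _ _ Ayv Ayv'.
have -> : v - v' = - gamma^-1 *: (y - y').
  have e' : y - y' = gamma *: (v' - v).
    rewrite scalerBr; apply/eqP.
    by rewrite subr_eq addrAC (addrC (gamma *: v')) -e addrK.
  by rewrite e' scalerA mulNr mulVf ?gt_eqF// scaleN1r opprB.
rewrite dotZr hdot mulNr -subr_ge0 -(pmulr_rge0 _ g0) => h.
have {}h : 0 <= - ((1 + gamma * alpha) * `|y - y'| ^+ 2).
  apply: le_trans h _; rewrite le_eqVlt; apply/orP; left; apply/eqP.
  by field; rewrite gt_eqF.
rewrite oppr_ge0 pmulr_rle0// in h.
have /eqP : `|y - y'| ^+ 2 = 0 by apply: le_anti; rewrite h exprn_ge0.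
by rewrite expf_eq0/= normr_eq0 subr_eq0 => /eqP.
Qed.

(** * The relaxed Douglas-Rachford operator *)

Section DouglasRachford.
Variables (A B : H -> set H) (alpha beta gamma delta lambda mu : R).
Hypotheses (hA : maximally_monotone dot alpha A)
  (hB : maximally_monotone dot beta B) (gamma0 : 0 < gamma) (delta0 : 0 < delta)
  (mu1 : 1 <= mu) (hga : 0 < 1 + 2 * gamma * alpha)
  (hmu : 2 - 2 * gamma * beta <= mu <= 2 + 2 * gamma * alpha)
  (hlm : (lambda - 1) * (mu - 1) = 1) (hdelta : delta = (lambda - 1) * gamma).
Let T := relaxed_resolvent delta B mu \o relaxed_resolvent gamma A lambda.

Let JA0 : 0 < 1 + gamma * alpha. Proof. move: hga; lra. Qed.

Let lambda_gt1 : 0 < lambda - 1.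
Proof. by move: delta0; rewrite hdelta pmulr_lgt0. Qed.

Let JB0 : 0 < 1 + delta * beta.
Proof.
case/andP: hmu => h _; rewrite hdelta.
(* Multiplied by lambda - 1, the lower bound on mu becomes lambda <= 2 (1 + delta beta). *)
have := ler_wpM2l (ltW lambda_gt1) h; move: hlm lambda_gt1; lra.
Qed.

Let mudelta : (mu - 1) * delta = gamma.
Proof. by rewrite hdelta mulrA (mulrC (mu - 1)) hlm mul1r. Qed.

(** Relaxation keeps the point p of a resolvent pair and rescales v: (1 - lambda) gamma = - delta,
    and for B likewise (1 - mu) delta = - gamma. *)
Lemma DR_decomposition x : exists p v w b,
  [/\ A p v, B w b, x = p + gamma *: v, p - delta *: v = w + delta *: b &
      T x = w - gamma *: b].
Proof.
have [v Av xE] := resolvent_spec hA gamma0 JA0 x.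
set p := resolvent gamma A x in Av xE.
have RA : relaxed_resolvent gamma A lambda x = p - delta *: v.
  rewrite /relaxed_resolvent -/p xE scalerDr addrAC -scalerDl subrK scale1r.
  by rewrite scalerA -opprB mulNr -hdelta scaleNr.
have [b Bb zE] := resolvent_spec hB delta0 JB0 (p - delta *: v).
set w := resolvent _ _ _ in Bb zE.
exists p, v, w, b; split => //.
rewrite /T /= RA /relaxed_resolvent -/w {1}zE scalerDr addrAC -scalerDl subrK scale1r.
by rewrite scalerA -opprB mulNr mudelta scaleNr.
Qed.

Let subrBB (c d e f : H) : c - d - (e - f) = (c - e) - (d - f).
Proof. by rewrite !opprB addrACA [RHS]addrACA (addrC (- d)). Qed.

Lemma DR_nonexpansive x y : `|T x - T y| <= `|x - y|.
Proof.
have [p [v [w [b [Av Bb -> e ->]]]]] := DR_decomposition x.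
have [p' [v' [w' [b' [Av' Bb' -> e' ->]]]]] := DR_decomposition y.
have := hA.1 _ _ _ _ Av Av'; have := hB.1 _ _ _ _ Bb Bb'.
have {e e'} : (p - p') - delta *: (v - v') = (w - w') + delta *: (b - b').
  by rewrite scalerBr subrBB e e' opprD addrACA scalerBr.
rewrite -!hdot.
have -> : p + gamma *: v - (p' + gamma *: v') = (p - p') + gamma *: (v - v').
  by rewrite opprD addrACA scalerBr.
have -> : w - gamma *: b - (w' - gamma *: b') = (w - w') - gamma *: (b - b').
  by rewrite subrBB scalerBr.
move: (p - p') (v - v') (w - w') (b - b') {Av Bb Av' Bb'} => {}p {}v {}w {}b e mB mA.
rewrite -ler_sqr ?nnegrE// -!hdot !dotE.
have := congr1 (fun z => dot z z) e; rewrite !dotE.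
rewrite (dotC v p) (dotC b w) => {}e.
have p0 := dot_ge0 p; have w0 := dot_ge0 w.
move: (dot p p) (dot w w) (dot v v) (dot b b) (dot p v) (dot w b) mA mB e p0 w0.
move=> pp ww vv bb pv wb mA mB e p0 w0.
have /andP[h1 h2] := hmu.
have k1 : 0 <= (2 + 2 * gamma * alpha - mu) * pp by rewrite mulr_ge0// subr_ge0.
have k2 : 0 <= (mu - (2 - 2 * gamma * beta)) * ww by rewrite mulr_ge0// subr_ge0.
have k3 : 0 <= 2 * gamma * (pv - alpha * pp).
  by rewrite mulr_ge0 ?subr_ge0// mulr_ge0// ltW.
have k4 : 0 <= 2 * gamma * (wb - beta * ww).
  by rewrite mulr_ge0 ?subr_ge0// mulr_ge0// ltW.
(* The second factor is the sum of [k1] to [k4], in which alpha and beta cancel. *)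
have k5 : 0 <= mu * ((2 - mu) * (pp - ww) + 2 * gamma * (pv + wb)).
  by rewrite mulr_ge0 ?(le_trans ler01 mu1)//; lra.
rewrite -subr_ge0; apply: le_trans k5 _; rewrite -subr_ge0 le_eqVlt.
apply/orP; left; apply/eqP.
(* As (mu - 1) delta = gamma, what remains after [k5] is (mu - 1)^2 times |p - delta v|^2 - |w +
   delta b|^2, which [e] makes zero. *)
transitivity ((mu - 1) ^+ 2 * (pp - 2 * delta * pv + delta ^+ 2 * vv
   - (ww + 2 * delta * wb + delta ^+ 2 * bb))); last by rewrite -mudelta; ring.
apply/esym/eqP; rewrite mulf_eq0 subr_eq0; apply/orP; right; apply/eqP.
move: e => /eqP; rewrite -subr_eq0 => /eqP e; apply/eqP; rewrite -subr_eq0 -e.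
by apply/eqP; ring.
Qed.

(** With a in A x and - a in B x, the fixed point is x + gamma a: uniqueness of resolvents
    identifies its decomposition. *)
Lemma DR_fixpoint : zer (sum_op A B) !=set0 -> fixpoints T !=set0.
Proof.
move=> [x [a [b [Aa Bb /esym /eqP]]]]; rewrite addrC addr_eq0 => /eqP bE.
exists (x + gamma *: a); rewrite /fixpoints/=.
have [p [v [w [b' [Av Bw e1 e2 ->]]]]] := DR_decomposition (x + gamma *: a).
have px := resolvent_unique hA.1 gamma0 JA0 Aa Av e1; subst p.
move: e1 => /addrI /(scalerI (lt0r_neq0 gamma0)) ?; subst v.
have xw : x = w.
  apply: (resolvent_unique hB.1 delta0 JB0 Bb Bw).
  by rewrite bE scalerN.
subst w; move: e2 => /addrI; rewrite -scalerN => /(scalerI (lt0r_neq0 delta0)) <-.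
by rewrite scalerN opprK.
Qed.

End DouglasRachford.
End InnerProduct.

(** * Absolutely continuous functions *)

Section AbsoluteContinuity.
Context {R : realType}.
Local Notation leb := (@lebesgue_measure R).

Lemma disjoint_itv_length_le (n : nat) (x y : 'I_n -> R) (U : set R) :
  measurable U -> (forall i, x i <= y i) -> (forall i, `]x i, y i[ `<=` U) ->
  trivIset setT (fun i => `]x i, y i[%classic) ->
  ((\sum_(i < n) (y i - x i))%:E <= leb U)%E.
Proof.
move=> mU xy sU triv.
have -> : ((\sum_(i < n) (y i - x i))%:E = \sum_(i < n) leb `]x i, y i[%classic)%E.
  rewrite -sumEFin; apply: eq_bigr => i _; rewrite lebesgue_measure_itv/= lte_fin.
  have := xy i; rewrite le_eqVlt => /predU1P[->|->]; last by rewrite EFinB.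
  by rewrite ltxx subrr.
rewrite -measure_semi_additive_ord//.
- apply: le_measure; rewrite ?inE//; first exact: bigsetU_measurable.
  by rewrite -bigcup_seq => t [i _]; exact: sU.
- exact: bigsetU_measurable.
Qed.

(* U has small measure and contains the exceptional null set. Points outside
   it are passed by the bound on the increments, points of U by adding an
   interval to a finite family over which phi varies little. *)
Lemma ac_increment_le (phi G : R -> R) (a b : R) :
  a <= b -> absolutely_continuous a b phi ->
  (forall s t, s <= t -> G s <= G t) ->
  {ae leb, forall t, a <= t < b -> forall e : R, 0 < e -> exists2 d, 0 < d &
     forall h : R, 0 < h < d -> phi (t + h) - phi t <= G (t + h) - G t + e * h} ->
  phi b - phi a <= G b - G a.
Proof.
move=> ab ac Gmono [N [mN N0 sN]].
(* The error consists of e (b - a) from the slopes, e from [eta] and e from the increments over the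
   family in U. *)
apply: (@le_of_small _ _ _ (2 + (b - a))) => e e0 _.
have [d d0 acd] := ac e e0.
have Noo : (leb N < +oo)%E by rewrite N0.
have [U [oU NU muU]] := lebesgue_regularity_outer mN Noo d0.
have mU : measurable U by exact: open_measurable.
have {}muU : (leb U < d%:E)%E.
  rewrite -(setDUK NU) measureU//; last 2 first.
    exact: measurableD.
    by rewrite setDE setICA setICr setI0.
  by rewrite [X in (X + _)%E]N0 add0e.
pose fam c eta := exists (n : nat) (x y : 'I_n -> R),
  [/\ forall i, a <= x i /\ x i <= y i /\ y i <= c,
      trivIset setT (fun i => `]x i, y i[%classic),
      forall i, `]x i, y i[ `<=` U &
      phi c - phi a <= G c - G a + e * (c - a) + eta
                       + \sum_(i < n) `|phi (y i) - phi (x i)| ].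
(* Induction along the interval: S contains its supremum, and a supremum below b could be exceeded
   within S. *)
pose S := [set c | a <= c <= b /\ forall eta, 0 < eta -> fam c eta].
have Sa : S a.
  split=> [|eta eta0]; first by rewrite lexx.
  exists 0%N, (fun=> a), (fun=> a); split => [i|i|i|] //; try by case: i.
  by rewrite big_ord0 !subrr; lra.
have Sub : ubound S b by move=> c [/andP[]].
have Ssup : has_sup S by split; [exists a|exists b].
set c := sup S.
have ac_ : a <= c by apply: ub_le_sup => //; exists b.
have cb : c <= b by apply: ge_sup => //; exists a.
have Sc : S c.
  split=> [|eta eta0]; first by rewrite ac_.
  (* Half of [eta] goes to the family at s, the other half to the increment from s to c, over a
     single interval shorter than r. *)
  have [r r0 acr] := ac (eta / 2) ltac:(by rewrite divr_gt0).
  have [s Ss sc] := sup_adherent r0 Ssup.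
  have sc' : s <= c by apply: ub_le_sup => //; exists b.
  have [/andP[as_ sb] famS] := Ss.
  have [n [x [y [hxy triv sU hs]]]] := famS (eta / 2) ltac:(by rewrite divr_gt0).
  exists n, x, y; split => // [i|].
    by have [? [? ?]] := hxy i; split => //; split => //; exact: le_trans sc'.
  have : \sum_(i < 1) `|phi c - phi s| < eta / 2.
    apply: (acr 1%N (fun=> s) (fun=> c)) => [i||]; first by [].
      by move=> i j _ _ _; rewrite !ord1.
    by rewrite big_ord1 ltrBlDr -ltrBlDl; move: sc; rewrite -/c; lra.
  rewrite big_ord1 => /(le_lt_trans (ler_norm _)) h1.
  have := Gmono _ _ sc'; have : e * (s - a) <= e * (c - a).
    by apply: ler_wpM2l; [exact: ltW|lra].
  lra.
have cbE : c = b.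
  apply/eqP; rewrite eq_le cb /= leNgt; apply/negP => {}cb.
  suff [t ct St] : exists2 t, c < t & S t.
    by move: ct; rewrite ltNge => /negP; apply; apply: ub_le_sup => //; exists b.
  have [_ famC] := Sc.
  have [Nc|Nc] := pselect (N c).
    have : nbhs c U by apply: open_nbhs_nbhs; split => //; exact: NU.
    move=> /nbhs_ballP[r /= r0 rU].
    pose t := Num.min (c + r / 2) b.
    have ct : c < t by rewrite lt_min cb andbT ltrDl divr_gt0.
    have tb : t <= b by rewrite ge_min lexx orbT.
    have ctU : `]c, t[ `<=` U.
      move=> z /=; rewrite in_itv/= lt_min => /andP[cz /andP[zr _]].
      apply: rU; rewrite /ball/= ltr_distlC; apply/andP; split; lra.
    exists t => //; split=> [|eta eta0]; first by rewrite tb (le_trans ac_ (ltW ct)).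
    have [n [x [y [hxy triv sU hs]]]] := famC eta eta0.
    pose ext (z : R) (f : 'I_n -> R) (i : 'I_n.+1) :=
      if unlift ord0 i is Some j then f j else z.
    have ext0 z f : ext z f ord0 = z by rewrite /ext unlift_none.
    have extS z f j : ext z f (lift ord0 j) = f j by rewrite /ext liftK.
    have disj i u : `]x i, y i[%classic u -> `]c, t[%classic u -> False.
      rewrite /= !in_itv/= => /andP[_ uy] /andP[cu _].
      by have [_ [_ yc]] := hxy i; move: (lt_trans cu uy); rewrite ltNge yc.
    exists n.+1, (ext c x), (ext t y); split.
    - move=> i; case: (unliftP ord0 i) => [j ->|->]; rewrite ?ext0 ?extS.
        by have [? [? ?]] := hxy j; split => //; split => //; exact: le_trans (ltW ct).
      by split => //; split => //; exact: ltW.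
    - move=> i j _ _; case: (unliftP ord0 i) => [i' ->|->];
        case: (unliftP ord0 j) => [j' ->|->]; rewrite ?ext0 ?extS => -[u [h1 h2]] //.
      + by congr lift; apply: triv => //; exists u.
      + by case: (disj i' u).
      + by case: (disj j' u).
    - by move=> i; case: (unliftP ord0 i) => [j ->|->]; rewrite ?ext0 ?extS.
    - rewrite big_ord_recl !ext0; under eq_bigr do rewrite !extS.
      have := ler_norm (phi t - phi c); have := Gmono _ _ (ltW ct).
      have : e * (c - a) <= e * (t - a) by apply: ler_wpM2l; [exact: ltW|lra].
      lra.
  have [r r0 hr] : exists2 r, 0 < r & forall h, 0 < h < r ->
      phi (c + h) - phi c <= G (c + h) - G c + e * h.
    have : ~ (~` [set t | a <= t < b -> forall e : R, 0 < e -> exists2 d, 0 < d &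
     forall h : R, 0 < h < d -> phi (t + h) - phi t <= G (t + h) - G t + e * h]) c.
      by move=> /sN.
    by move=> /contrapT /=; apply => //; rewrite ac_.
  pose t := Num.min (c + r / 2) b.
  have ct : c < t by rewrite lt_min cb andbT ltrDl divr_gt0.
  have tb : t <= b by rewrite ge_min lexx orbT.
  have tr : t <= c + r / 2 by rewrite ge_min lexx.
  exists t => //; split=> [|eta eta0]; first by rewrite tb (le_trans ac_ (ltW ct)).
  have [n [x [y [hxy triv sU hs]]]] := famC eta eta0.
  exists n, x, y; split => // [i|].
    by have [? [? ?]] := hxy i; split => //; split => //; exact: le_trans (ltW ct).
  have := hr (t - c); rewrite subrKC => /(_ _) h.
  have {}h : phi t - phi c <= G t - G c + e * (t - c).
    by apply: h; apply/andP; split; lra.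
  lra.
have [_ /(_ e e0)[n [x [y [hxy triv sU hs]]]]] := Sc.
rewrite cbE in hxy hs.
have : \sum_(i < n) `|phi (y i) - phi (x i)| < e.
  apply: acd => //; rewrite -lte_fin; apply: le_lt_trans muU.
  by apply: disjoint_itv_length_le => // i; have [_ []] := hxy i.
lra.
Qed.

(** Carries the absolute continuity of the trajectory over to distance, residual and energy, whose
    increments are dominated by those of u and t. *)
Lemma ac_of_increment_le (V W : normedModType R) (u : R -> V) (phi : R -> W)
    (a b K L : R) : 0 <= K -> 0 <= L -> absolutely_continuous a b u ->
  (forall s t, a <= s -> s <= t -> t <= b ->
     `|phi t - phi s| <= K * `|u t - u s| + L * (t - s)) ->
  absolutely_continuous a b phi.
Proof.
move=> K0 L0 ac h e e0.
have K1 : 0 < K + 1 by lra. have L1 : 0 < L + 1 by lra.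
have [d d0 hd] := ac (e / 2 / (K + 1)) ltac:(by rewrite !divr_gt0).
exists (Num.min d (e / 2 / (L + 1))); first by rewrite lt_min d0 !divr_gt0.
move=> n x y hxy triv; rewrite lt_min => /andP[/(hd n x y hxy triv) h1 h2].
apply: (@le_lt_trans _ _ (\sum_(i < n) (K * `|u (y i) - u (x i)| + L * (y i - x i)))).
  by apply: ler_sum => i _; have [? []] := hxy i; exact: h.
rewrite big_split/= -!mulr_sumr [e in _ < e](splitr e).
rewrite ltr_pdivlMr// in h1; rewrite ltr_pdivlMr// in h2.
apply: ltr_leD.
  apply: le_lt_trans h1; rewrite mulrC ler_wpM2l ?lerDl//.
  by apply: sumr_ge0 => i _.
apply: le_trans (ltW h2); rewrite mulrC ler_wpM2l ?lerDl//.
by apply: sumr_ge0 => i _; have [_ [? _]] := hxy i; rewrite subr_ge0.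
Qed.

End AbsoluteContinuity.

(** * Integrals of nonnegative functions *)

Section Increments.
Context {R : realType} {V : normedModType R}.

Lemma derivable_increment (u : R -> V) (t : R) : derivable u t 1 ->
  forall e : R, 0 < e -> exists2 d, 0 < d & forall h : R, 0 < h < d ->
    `|u (t + h) - u t - h *: 'D_1 u t| <= e * h.
Proof.
move=> du e e0.
have /cvgrPdist_le /(_ e e0) :
    h^-1 *: (u (h *: 1 + t) - u t) @[h --> (0 : R)^'] --> 'D_1 u t.
  exact: du.
rewrite near_withinE => /nbhs_ballP[d /= d0 hd]; exists d => // h /andP[h0 hdlt].
have := hd h; rewrite /ball/= sub0r normrN gtr0_norm// => /(_ hdlt (lt0r_neq0 h0)).
rewrite (_ : h *: 1 = h) ?(addrC h) => [h1|]; last exact: mulr1.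
have -> : u (t + h) - u t - h *: 'D_1 u t =
    - (h *: ('D_1 u t - h^-1 *: (u (t + h) - u t))).
  by rewrite scalerBr scalerA divff ?gt_eqF// scale1r opprB.
by rewrite normrN normrZ gtr0_norm// mulrC ler_wpM2r// ltW.
Qed.

End Increments.

Section NonnegativeIntegrals.
Context {R : realType}.
Local Notation leb := (@lebesgue_measure R).
Import HBNNSimple.

(* The library version assumes both functions measurable. *)
Lemma ge0_le_integral_nonmeasurable (D E : set R) (h k : R -> \bar R) :
  (forall x, D x -> 0 <= h x)%E -> (forall x, E x -> 0 <= k x)%E ->
  (forall x, D x -> E x -> h x <= k x)%E -> (forall x, D x -> ~ E x -> h x = 0)%E ->
  (\int[leb]_(x in D) h x <= \int[leb]_(x in E) k x)%E.
Proof.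
move=> h0 k0 hk hE; rewrite !ge0_integralE//; apply: le_ereal_sup.
move=> _ [g /= gh <-]; exists g => //= x; apply: le_trans (gh x) _.
rewrite !patchE; case: (pselect (E x)) => Ex.
  by rewrite (mem_set Ex); case: ifPn => [|_]; rewrite ?inE ?k0// => Dx; exact: hk.
by rewrite (memNset Ex); case: ifPn => //; rewrite inE => Dx; rewrite hE.
Qed.

(** The integral is a supremum over simple functions, which are bounded and measurable, so bounding
    such minorants of [h] suffices. *)
Lemma ge0_integral_le_simple (D : set R) (h : R -> R) (C : \bar R) :
  (forall x, D x -> 0 <= h x) ->
  (forall (g : R -> R) (K : R), measurable_fun setT g ->
     (forall x, 0 <= g x <= K) -> (forall x, D x -> g x <= h x) ->
     (forall x, ~ D x -> g x = 0) -> (\int[leb]_x (g x)%:E <= C)%E) ->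
  (\int[leb]_(x in D) (h x)%:E <= C)%E.
Proof.
move=> h0 hC; rewrite ge0_integralE//; apply: ge_ereal_sup => _ [g /= gh <-].
have -> : sintegral leb g = (\int[leb]_x (g x)%:E)%E.
  by rewrite integral_nnsfun// patch_setT.
have [K [_ /(_ (K + 1))]] := simple_bounded g.
rewrite ltrDl => /(_ ltr01) gK.
apply: (hC g (K + 1)); first exact: (measurable_funPT g).
- move=> x; apply/andP; split; first exact: fun_ge0.
  apply: le_trans (ler_norm _) _; exact: gK.
- by move=> x Dx; have := gh x; rewrite patchE mem_set// lee_fin.
- move=> x nDx; have := gh x; rewrite patchE memNset// lee_fin => gx.
  by apply/eqP; rewrite eq_le gx/=; exact: fun_ge0.
Qed.

(** * Primitives and their derivatives almost everywhere *)

Definition primitive (g : R -> R) (x : R) : R :=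
  (\int[leb]_(t in `]-oo, x]) g t)%R.

Section Primitive.
Variable g : R -> R.
Hypotheses (mg : measurable_fun setT g) (g0 : forall x, 0 <= g x)
  (ig : (\int[leb]_x (g x)%:E < +oo)%E).

Let intg : leb.-integrable setT (EFin \o g).
Proof.
apply/integrableP; split; first exact/measurable_EFinP.
by under eq_integral do rewrite /= ger0_norm//.
Qed.

Let intgS D : measurable D -> leb.-integrable D (EFin \o g).
Proof. by move=> mD; apply: integrableS intg. Qed.

Lemma primitiveE x : (primitive g x)%:E = (\int[leb]_(t in `]-oo, x]) (g t)%:E)%E.
Proof.
by rewrite /primitive /Rintegral fineK//; apply: integrable_fin_num => //; exact: intgS.
Qed.

Lemma primitive_increment s t : s <= t ->
  (primitive g t - primitive g s)%:E = (\int[leb]_(x in `]s, t]) (g x)%:E)%E.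
Proof.
move=> st; rewrite EFinB !primitiveE.
have -> : `]-oo, t]%classic = `]-oo, s] `|` `]s, t].
  by rewrite -itv_bndbnd_setU//= bnd_simp.
rewrite ge0_integral_setU//=.
- by rewrite addeAC subee ?add0e//; apply: integrable_fin_num => //; exact: intgS.
- by apply/measurable_EFinP; exact: measurable_funTS.
- by move=> x _; rewrite lee_fin.
- apply/disj_setPLR => x /=; rewrite !in_itv/= => xs /andP[/lt_le_trans /(_ xs)].
  by rewrite ltxx.
Qed.

Lemma primitive_ge0 x : 0 <= primitive g x.
Proof. by rewrite -lee_fin primitiveE integral_ge0// => y _; rewrite lee_fin. Qed.

Lemma primitive_nondecreasing s t : s <= t -> primitive g s <= primitive g t.
Proof.
move=> st; rewrite -subr_ge0 -lee_fin primitive_increment//.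
by rewrite integral_ge0// => y _; rewrite lee_fin.
Qed.

Lemma primitive_le x : ((primitive g x)%:E <= \int[leb]_t (g t)%:E)%E.
Proof.
rewrite primitiveE; apply: ge0_subset_integral => //=.
- exact/measurable_EFinP.
- by move=> y _; rewrite lee_fin.
Qed.

Lemma primitive_lipschitz K s t : (forall x, g x <= K) -> s <= t ->
  primitive g t - primitive g s <= K * (t - s).
Proof.
move=> gK st; rewrite -lee_fin primitive_increment//.
apply: (@le_trans _ _ (\int[leb]_(x in `]s, t]) K%:E)%E).
  apply: ge0_le_integral => //=.
  - by move=> x _; rewrite lee_fin.
  - by apply/measurable_EFinP; exact: measurable_funTS.
  - by move=> x _; rewrite lee_fin.
rewrite integral_cst//= lebesgue_measure_itv/= lte_fin.
have := st; rewrite le_eqVlt => /predU1P[->|->]; last by rewrite -EFinB -EFinM.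
by rewrite ltxx mule0 subrr mulr0.
Qed.

Lemma primitive_derivable_ae : {ae leb, forall t, forall e : R, 0 < e ->
  exists2 d, 0 < d & forall h : R, 0 < h < d ->
    `|primitive g (t + h) - primitive g t - h * g t| <= e * h}.
Proof.
have lg : locally_integrable setT g by apply: open_integrable_locally => //; exact: openT.
have := @FTC1Ny R g (fun y => intgS (measurable_itv _)) lg.
apply: filterS; first exact: (ae_filter_ringOfSetsType leb).
move=> t [dt tE] e e0.
have [d d0 hd] := derivable_increment dt e0; exists d => // h hh.
by have := hd h hh; rewrite -derive1E tE.
Qed.

Lemma integral_le_of_halfline (a : R) (C : \bar R) :
  (forall x, a <= x -> (\int[leb]_(t in `]-oo, x]) (g t)%:E <= C)%E) ->
  (\int[leb]_t (g t)%:E <= C)%E.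
Proof.
move=> gC; have -> : [set: R] = \bigcup_n `]-oo, (a + n%:R : R)]%classic.
  apply/esym; rewrite -subTset => x _; exists (Num.bound `|x - a|) => //=.
  rewrite in_itv/= -lerBlDl; apply: le_trans (ler_norm _) _.
  by apply/ltW/archi_boundP/normr_ge0.
have c := @ge0_nondecreasing_set_cvg_integral _ (measurableTypeR R) R
  (fun n : nat => `]-oo, (a + n%:R : R)]%classic) (EFin \o g) leb.
apply: (cvge_to_le (c _ _ _ _)).
- move=> m n mn; apply/subsetPset => x /=; rewrite !in_itv/= => /le_trans; apply.
  by rewrite lerD2l ler_nat.
- by move=> n; exact: measurable_itv.
- by move=> n; apply/measurable_EFinP; exact: measurable_funTS.
- by move=> n x _; rewrite lee_fin.
- by apply: nearW => n; apply: gC; rewrite lerDl.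
Qed.

End Primitive.
Lemma measurable_norm_simple (V : normedModType R) (s : R -> V) :
  simple_function s -> measurable_fun setT (fun t => `|s t|).
Proof.
move=> [fs ms] _ Y mY; rewrite setTI.
have -> : (fun t => `|s t|) @^-1` Y =
    \bigcup_(y in range s `&` [set y | Y `|y|]) s @^-1` [set y].
  apply/seteqP; split => [t Yt|t [y [_ Yy] /= ->//]].
  by exists (s t) => //; split => //; exists t.
by apply: fin_bigcup_measurable => [|y _]; [exact: finite_setIl|exact: ms].
Qed.

(** Off the null set where the simple approximations may fail to converge, |f| is a pointwise limit
    of measurable functions; setting it to 0 elsewhere gives F. *)
Lemma bochner_integrable_majorant (V : normedModType R) (D : set R) (f : R -> V) :
  measurable D -> bochner_integrable D f ->
  exists F : R -> R, [/\ measurable_fun setT F, forall x, 0 <= F x,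
    (\int[leb]_x (F x)%:E < +oo)%E & {ae leb, forall t, D t -> `|f t| <= F t}].
Proof.
move=> mD [[s ss [N [mN N0 sN]]] foo].
pose E := D `\` N; have mE : measurable E by exact: measurableD.
have mF : measurable_fun setT ((fun t => `|f t|) \_ E).
  apply: (@measurable_fun_cvg _ _ _ setT (fun n => (fun t => `|s n t|) \_ E)).
    move=> n; apply/(measurable_restrictT _ _).1 => //.
    by apply: measurable_funTS; exact: measurable_norm_simple.
  move=> t _; rewrite patchE; case: ifPn => Et; last first.
    by under eq_fun do rewrite patchE (negbTE Et); exact: cvg_cst.
  under eq_fun do rewrite patchE Et.
  move: Et; rewrite inE => -[Dt nNt]; apply: cvg_norm.
  by apply: contrapT => nc; apply/nNt/sN => /= /(_ Dt).
exists ((fun t => `|f t|) \_ E); split => //.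
- by move=> x; rewrite patchE; case: ifP.
- apply: le_lt_trans foo; have -> :
      (\int[leb]_x (((fun t => `|f t|) \_ E) x)%:E = \int[leb]_(x in E) `|f x|%:E)%E.
    rewrite [RHS]integral_mkcond; apply: eq_integral => x _.
    by rewrite !patchE; case: ifP.
  by apply: ge0_le_integral_nonmeasurable => // x [].
- exists N; split => //; apply: subsetC2; rewrite setCK => t /= nNt Dt.
  by rewrite patchE mem_set.
Qed.

End NonnegativeIntegrals.

(** * Estimates along the trajectory *)

Section Trajectory.
Context {R : realType} {H : completeNormedModType R}.
Local Notation leb := (@lebesgue_measure R).
Variables (dot : {dot H for idfun}) (hdot : induces_norm dot).

Lemma absolutely_continuous_sub (V : normedModType R) (u : R -> V) (a b c d : R) :
  a <= c -> d <= b -> absolutely_continuous a b u -> absolutely_continuous c d u.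
Proof.
move=> ac db h e /h[r r0 hr]; exists r => // n x y hxy; apply: hr => i.
have [cx [xy yd]] := hxy i; split; first exact: le_trans cx.
by split => //; exact: le_trans db.
Qed.

Lemma convex_comb_sub (s : R) (x y z : H) :
  (1 - s) *: x + s *: y - z = (1 - s) *: (x - z) + s *: (y - z).
Proof. by rewrite !scalerBr addrACA -opprD -scalerDl subrK scale1r. Qed.

Lemma ge0_normZ (s : R) (x : H) : 0 <= s -> `|s *: x| = s * `|x|.
Proof. by move=> s0; rewrite normrZ ger0_norm. Qed.

Lemma norm_convex_comb (s : R) (x y : H) : `|(1 - s) *: x + s *: y| ^+ 2 =
  (1 - s) * `|x| ^+ 2 + s * `|y| ^+ 2 - s * (1 - s) * `|x - y| ^+ 2.
Proof. by rewrite -!hdot !(dotE dot) (dotC dot y x); ring. Qed.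

Variables (T : H -> H) (hT : forall x y, `|T x - T y| <= `|x - y|).
Variables (t0 : R) (theta : R -> R) (theta0 : forall t, t0 <= t -> 0 <= theta t).
Variables (f : R -> H) (u : R -> H).
Hypothesis ac : forall b, t0 < b -> absolutely_continuous t0 b u.
Hypothesis ode : {ae leb, forall t, t0 <= t ->
  derivable u t 1 /\ 'D_1 u t + theta t *: (u t - T (u t)) = f t}.
Variable F : R -> R.
Hypotheses (mF : measurable_fun setT F) (F0 : forall x, 0 <= F x)
  (iF : (\int[leb]_x (F x)%:E < +oo)%E)
  (fF : {ae leb, forall t, t0 <= t -> `|f t| <= F t}).
Let G := primitive F.
Let r t := `|T (u t) - u t|.

(** An explicit Euler step: by the equation its error is the remainder of the derivative plus h
    f(t), and h |f(t)| is charged to the increment of G. *)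
Lemma trajectory_step : {ae leb, forall t, t0 <= t -> forall e : R, 0 < e ->
  exists2 d, 0 < d & forall h : R, 0 < h < d ->
    [/\ 0 <= h * theta t, h * theta t <= 1 &
     `|u (t + h) - ((1 - h * theta t) *: u t + (h * theta t) *: T (u t))|
       <= G (t + h) - G t + e * h] }.
Proof.
move: ode fF (primitive_derivable_ae mF F0 iF); apply: filterS3.
  exact: (ae_filter_ringOfSetsType leb).
move=> t odet ft Gt tt0 e e0; have [du uE] := odet tt0.
have e2 : 0 < e / 2 by rewrite divr_gt0.
have [d1 d10 h1] := derivable_increment du e2.
have [d2 d20 h2] := Gt _ e2.
have th0 := theta0 tt0.
have th1 : 0 < theta t + 1 by rewrite ltr_wpDl.
(* The last bound keeps the weight h theta(t) below 1, also where theta vanishes. *)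
exists (Num.min d1 (Num.min d2 (theta t + 1)^-1)).
  by rewrite !lt_min d10 d20 invr_gt0.
move=> h /andP[h0]; rewrite !lt_min => /andP[hd1 /andP[hd2 hth]].
split; first by rewrite mulr_ge0// ltW.
  have : h * (theta t + 1) < 1 by rewrite -ltr_pdivlMr// div1r.
  lra.
have {}h1 := h1 h; rewrite h0 hd1 in h1; have {}h1 := h1 isT.
have {}h2 := h2 h; rewrite h0 hd2 in h2; have {}h2 := h2 isT.
have -> : u (t + h) - ((1 - h * theta t) *: u t + (h * theta t) *: T (u t)) =
    u (t + h) - u t - h *: 'D_1 u t + h *: f t.
  have -> : (1 - h * theta t) *: u t + (h * theta t) *: T (u t) =
      u t - (h * theta t) *: (u t - T (u t)).
    by rewrite scalerBl scale1r scalerBr opprB -addrA (addrC (- _)).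
  by rewrite -uE (scalerDr h) scalerA [RHS]addrA subrK opprB (addrC (_ *: _)) addrA.
apply: le_trans (ler_normD _ _) _; rewrite normrZ gtr0_norm//.
have hf : h * `|f t| <= h * F t by rewrite ler_wpM2l ?ft// ltW.
have := ler_norm (- (G (t + h) - G t - h * F t)); rewrite normrN.
lra.
Qed.

Lemma residualE t : r t = `|u t - T (u t)|.
Proof. exact: distrC. Qed.

(** The convex combination in the Euler step is no farther from z than u is, so only the error can
    increase the distance. *)
Lemma distance_growth z s t : T z = z -> t0 <= s -> s <= t ->
  `|u t - z| - `|u s - z| <= G t - G s.
Proof.
(* [ac] asks for a right end beyond t0, whereas t = t0 is allowed here. *)
move=> Tz ts st; have ab : t0 < t + 1 by lra.
apply: (@ac_increment_le _ (fun x => `|u x - z|)) => //.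
- apply: (@ac_of_increment_le _ _ _ u _ _ _ 1 0) => //.
    by apply: absolutely_continuous_sub (ac ab); lra.
  move=> x y _ _ _; rewrite mul1r mul0r addr0.
  have -> : u y - u x = (u y - z) - (u x - z) by rewrite opprB addrA subrK.
  exact: ler_dist_dist.
- by move=> x y; exact: primitive_nondecreasing.
move: trajectory_step; apply: filterS; first exact: (ae_filter_ringOfSetsType leb).
move=> x step /andP[sx _] e e0; have [d d0 hd] := step (le_trans ts sx) e e0.
exists d => // h hh; have [s0 s1 hu] := hd h hh.
set c : R := h * theta x in s0 s1 hu.
have : `|(1 - c) *: u x + c *: T (u x) - z| <= `|u x - z|.
  rewrite convex_comb_sub; apply: le_trans (ler_normD _ _) _.
  rewrite !ge0_normZ ?subr_ge0//.
  have := hT (u x) z; rewrite Tz => /(ler_wpM2l s0); lra.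
have := ler_distD ((1 - c) *: u x + c *: T (u x)) (u (x + h)) z.
lra.
Qed.

(** The Euler point q is at distance (1 - c) r from T (u x), and T (u x) moves by at most |u (x + h)
    - u x|, which is c r plus the error; the terms in c cancel and the error counts twice. *)
Lemma residual_growth s t : t0 <= s -> s <= t -> r t - r s <= 2 * (G t - G s).
Proof.
move=> ts st; have ab : t0 < t + 1 by lra.
rewrite mulrBr; apply: (@ac_increment_le _ r (fun x => 2 * G x)) => //.
- apply: (@ac_of_increment_le _ _ _ u _ _ _ 2 0) => //.
    by apply: absolutely_continuous_sub (ac ab); lra.
  move=> x y _ _ _; rewrite mul0r addr0 !residualE.
  apply: le_trans (ler_dist_dist _ _) _.
  have -> : u y - T (u y) - (u x - T (u x)) = (u y - u x) - (T (u y) - T (u x)).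
    by rewrite !opprB addrACA [RHS]addrACA (addrC (- T (u y))).
  apply: le_trans (ler_normB _ _) _.
  by have := hT (u y) (u x); lra.
- by move=> x y xy; rewrite ler_pM2l//; exact: primitive_nondecreasing.
move: trajectory_step; apply: filterS; first exact: (ae_filter_ringOfSetsType leb).
move=> x step /andP[sx _] e e0; have [|d d0 hd] := step (le_trans ts sx) (e / 2).
  by rewrite divr_gt0.
exists d => // h hh; have [s0 s1 hu] := hd h hh; rewrite !residualE.
set c : R := h * theta x in s0 s1 hu; set q := (1 - c) *: _ + _ in hu.
have qT : `|q - T (u x)| = (1 - c) * `|u x - T (u x)|.
  by rewrite /q convex_comb_sub subrr scaler0 addr0 ge0_normZ// subr_ge0.
have qu : `|q - u x| = c * `|u x - T (u x)|.
  by rewrite /q convex_comb_sub subrr scaler0 add0r ge0_normZ// distrC.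
have := ler_distD q (u (x + h)) (T (u (x + h))).
have := ler_distD (T (u x)) q (T (u (x + h))).
have := ler_distD q (u (x + h)) (u x).
have := hT (u x) (u (x + h)); rewrite (distrC (u x)).
lra.
Qed.

Let C := fine (\int[leb]_x (F x)%:E).

Lemma primitive_bounded x : 0 <= G x <= C.
Proof.
have fin : (\int[leb]_x (F x)%:E)%E \is a fin_num.
  by rewrite ge0_fin_numE// integral_ge0// => y _; rewrite lee_fin.
by rewrite primitive_ge0//= -lee_fin [leRHS]fineK//; exact: primitive_le.
Qed.

(** * Energy estimate and decay of the residual *)

Section Energy.
Variables (z : H) (Tz : T z = z).
Let M := `|u t0 - z| + C.

Lemma trajectory_bounded t : t0 <= t -> `|u t - z| <= M.
Proof.
move=> tt; have := distance_growth Tz (lexx t0) tt.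
have /andP[? ?] := primitive_bounded t; have /andP[? ?] := primitive_bounded t0.
rewrite /M; lra.
Qed.

(** The minorant g of theta r^2 has a Lipschitz primitive that is differentiable almost everywhere,
    so |u - z|^2 plus this primitive can be compared with 2 M G. *)
Lemma energy_growth (g : R -> R) (K : R) b :
  measurable_fun setT g -> (forall x, 0 <= g x <= K) ->
  (\int[leb]_x (g x)%:E < +oo)%E ->
  (forall x, t0 <= x -> g x <= theta x * r x ^+ 2) ->
  t0 <= b ->
  primitive g b - primitive g t0 <= `|u t0 - z| ^+ 2 + 2 * M * C.
Proof.
move=> mg gK ig gle tb; have ab : t0 < b + 1 by lra.
have g0 x : 0 <= g x by have /andP[] := gK x.
have gK' x : g x <= K by have /andP[] := gK x.
have K0 : 0 <= K by exact: le_trans (g0 0) (gK' 0).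
have M0 : 0 <= M by apply: le_trans (normr_ge0 _) (trajectory_bounded (lexx t0)).
have M20 : 0 <= 2 * M by rewrite mulr_ge0.
have : (`|u b - z| ^+ 2 + primitive g b) - (`|u t0 - z| ^+ 2 + primitive g t0)
    <= 2 * M * G b - 2 * M * G t0.
  apply: (@ac_increment_le _ (fun x => `|u x - z| ^+ 2 + primitive g x)
    (fun x => 2 * M * G x)) => //.
  - apply: (@ac_of_increment_le _ _ _ u _ _ _ (2 * M) K) => //.
      by apply: absolutely_continuous_sub (ac ab); lra.
    move=> x y tx xy _; rewrite opprD addrACA.
    apply: le_trans (ler_normD _ _) _; apply: lerD; last first.
      rewrite ger0_norm ?subr_ge0; last exact: primitive_nondecreasing.
      exact: primitive_lipschitz.
    rewrite subr_sqr normrM mulrC ler_pM//.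
      rewrite ger0_norm ?addr_ge0//.
      have := trajectory_bounded tx; have := trajectory_bounded (le_trans tx xy); lra.
    have -> : u y - u x = (u y - z) - (u x - z) by rewrite opprB addrA subrK.
    exact: ler_dist_dist.
  - by move=> x y xy; apply: ler_wpM2l => //; exact: primitive_nondecreasing.
  move: trajectory_step (primitive_derivable_ae mg g0 ig); apply: filterS2.
    exact: (ae_filter_ringOfSetsType leb).
  move=> x step dg /andP[tx _] e e0.
  have N0 : 0 < 2 * M + 2 by lra.
  (* The errors are 2 M e' h from the Euler step, e' h from the primitive and e' h from the
     second-order term h^2 w. *)
  pose e' := e / (2 * M + 2); have e'0 : 0 < e' by rewrite divr_gt0.
  have eE : e = (2 * M + 2) * e' by rewrite /e'; field; rewrite gt_eqF.
  have [d1 d10 h1] := step tx e' e'0; have [d2 d20 h2] := dg e' e'0.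
  pose w := (theta x * r x) ^+ 2.
  have w1 : 0 < w + 1 by rewrite ltr_wpDl// sqr_ge0.
  exists (Num.min d1 (Num.min d2 (e' / (w + 1)))).
    by rewrite !lt_min d10 d20 divr_gt0.
  move=> h /andP[h0]; rewrite !lt_min => /andP[hd1 /andP[hd2 hw]].
  have := h1 h; rewrite h0 hd1 => /(_ isT)[s0 s1 hu].
  have := h2 h; rewrite h0 hd2 => /(_ isT) /ler_normlW hg.
  have {}hw : h * (h * w) <= h * e'.
    rewrite ler_pM2l//; move: hw; rewrite ltr_pdivlMr//; nra.
  set c : R := h * theta x in s0 s1 hu; set q := (1 - c) *: _ + _ in hu.
  have q2 : `|q - z| ^+ 2 <= `|u x - z| ^+ 2 - c * (1 - c) * r x ^+ 2.
    rewrite /q convex_comb_sub norm_convex_comb.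
    have -> : u x - z - (T (u x) - z) = u x - T (u x) by rewrite opprB addrA subrK.
    rewrite -residualE.
    have : `|T (u x) - z| ^+ 2 <= `|u x - z| ^+ 2.
      by rewrite ler_sqr ?nnegrE// -{1}Tz hT.
    move=> /(ler_wpM2l s0); lra.
  have qM : `|q - z| <= M.
    apply: le_trans (trajectory_bounded tx); rewrite -ler_sqr ?nnegrE//.
    apply: le_trans q2 _; rewrite lerBlDr lerDl.
    by apply: mulr_ge0 (sqr_ge0 _); apply: mulr_ge0 => //; rewrite subr_ge0.
  have wM : `|u (x + h) - z| <= M by apply: trajectory_bounded; lra.
  have wq := le_trans (ler_distD q (u (x + h)) z) (lerD hu (lexx _)).
  have : `|u (x + h) - z| ^+ 2 - `|q - z| ^+ 2 <= 2 * M * (G (x + h) - G x + e' * h).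
    rewrite subr_sqr (mulrC (2 * M)).
    apply: le_trans (ler_wpM2l (le_trans (normr_ge0 _) hu) (_ : _ <= 2 * M)).
      by apply: ler_wpM2r; [rewrite addr_ge0|lra].
    lra.
  have := gle x tx => /(ler_wpM2l (ltW h0)).
  have cE : c * (1 - c) * r x ^+ 2 = h * (theta x * r x ^+ 2) - h * (h * w).
    by rewrite /c /w; ring.
  rewrite cE in q2; rewrite [in e * h]eE; lra.
have /andP[? ?] := primitive_bounded b; have /andP[? ?] := primitive_bounded t0.
have : 2 * M * (G b - G t0) <= 2 * M * C by apply: ler_wpM2l => //; lra.
have := sqr_ge0 `|u b - z|.
lra.
Qed.

(** [energy_growth] bounds all bounded measurable minorants on [t0, b], uniformly in b; then b tends
    to infinity. *)
Lemma energy_integral :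
  (\int[leb]_(t in `[t0, +oo[) (theta t * r t ^+ 2)%:E
     <= (`|u t0 - z| ^+ 2 + 2 * M * C)%:E)%E.
Proof.
apply: ge0_integral_le_simple => [x|g K mg gK gle gout].
  by rewrite /= in_itv/= andbT => tx; rewrite mulr_ge0 ?sqr_ge0 ?theta0.
have g0 x : 0 <= g x by have /andP[] := gK x.
apply: (integral_le_of_halfline mg g0 (a := t0)) => b tb.
(* A bounded g need not be integrable on the half-line; its restriction is. *)
pose gb := g \_ `[t0, b].
have mgb : measurable_fun setT gb.
  by apply/(measurable_restrictT _ _).1 => //; exact: measurable_funTS.
have gbK x : 0 <= gb x <= K.
  rewrite /gb patchE; case: ifP => // _; rewrite lexx.
  by have /andP[/le_trans h /h] := gK x.
have igb : (\int[leb]_x (gb x)%:E < +oo)%E.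
  apply: (@le_lt_trans _ _ (\int[leb]_(x in `[t0, b]) K%:E)%E).
    apply: ge0_le_integral_nonmeasurable.
    - by move=> x _; rewrite lee_fin; have /andP[] := gbK x.
    - by move=> x _; rewrite lee_fin; have /andP[/le_trans h /h] := gK x.
    - by move=> x _ _; rewrite lee_fin; have /andP[] := gbK x.
    - by move=> x _ nx; rewrite /gb patchE memNset.
  rewrite integral_cst//= lebesgue_measure_itv/= lte_fin.
  by case: ifP; rewrite ?mule0 ?ltry// -EFinB -EFinM ltry.
have gble x : t0 <= x -> gb x <= theta x * r x ^+ 2.
  move=> tx; rewrite /gb patchE; case: ifP => _; last first.
    by rewrite mulr_ge0 ?sqr_ge0 ?theta0.
  by apply: gle; rewrite /= in_itv/= tx.
have -> : (\int[leb]_(x in `]-oo, b]) (g x)%:E = (primitive gb b)%:E)%E.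
  rewrite primitiveE//; last by move=> x; have /andP[] := gbK x.
  apply: eq_integral => x; rewrite inE/= in_itv/= => xb; congr EFin.
  rewrite /gb patchE; case: ifPn => //; rewrite notin_setE/= in_itv/= xb andbT => tx.
  by rewrite gout//= in_itv/= andbT.
have p0 : primitive gb t0 = 0.
  apply: EFin_inj; rewrite primitiveE//; last by move=> x; have /andP[] := gbK x.
  (* The restriction keeps its value at t0, so this endpoint is first discarded as a null set. *)
  rewrite -integral_itv_bndo_bndc; last by apply/measurable_EFinP; exact: measurable_funTS.
  apply: integral0_eq => x /=; rewrite in_itv/= => xt; congr EFin.
  by rewrite /gb patchE memNset//= in_itv/= leNgt xt.
by have := energy_growth mgb gbK igb gble tb; rewrite p0 subr0 lee_fin.
Qed.

Hypothesis htheta : locally_integrable_from t0 theta.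
Hypothesis htheta_oo : (\int[leb]_(t in `[t0, +oo[) (theta t)%:E = +oo)%E.

(** If r stayed above c from t1 on, the energy bound would make the integral of theta after t1
    finite; up to t1 it is finite by local integrability. *)
Lemma residual_small (t1 c : R) : t0 < t1 -> 0 < c -> exists2 t, t1 <= t & r t < c.
Proof.
move=> t01 c0; apply: contrapT => N.
have rc t : t1 <= t -> c <= r t.
  by move=> tt; rewrite leNgt; apply/negP => h; apply: N; exists t.
have [_ fin1] := htheta t01.
have c20 : 0 < c ^+ 2 by rewrite exprn_gt0.
set E0 := `|u t0 - z| ^+ 2 + 2 * M * C.
suff : (\int[leb]_(t in `[t0, +oo[) (theta t)%:E <=
    \int[leb]_(t in `[t0, t1]) `|theta t|%:E + (E0 / c ^+ 2)%:E)%E.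
  rewrite htheta_oo leye_eq => /eqP e.
  by move: (lte_add_pinfty fin1 (ltry (E0 / c ^+ 2))); rewrite e.
apply: ge0_integral_le_simple => [x|g K mg gK gle gout].
  by rewrite /= in_itv/= andbT => /theta0.
have g0 x : 0 <= g x by have /andP[] := gK x.
have mg' : measurable_fun setT (EFin \o g) by exact/measurable_EFinP.
have -> : [set: R] = `]-oo, t1] `|` `]t1, +oo[ by rewrite -itv_bndbnd_setU// set_itvNyy.
rewrite ge0_integral_setU//=; first last.
- apply/disj_setPLR => x /=; rewrite !in_itv/= andbT => xt /lt_le_trans /(_ xt).
  by rewrite ltxx.
- by move=> x _; rewrite lee_fin.
- exact: measurable_funTS mg'.
apply: leeD.
  apply: ge0_le_integral_nonmeasurable.
  - by move=> x _; rewrite lee_fin.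
  - by move=> x _; rewrite lee_fin.
  - move=> x _; rewrite /= in_itv/= => /andP[tx _]; rewrite lee_fin.
    by apply: le_trans (ler_norm _); apply: gle; rewrite /= in_itv/= tx.
  - move=> x /=; rewrite !in_itv/= => xt nx; congr EFin.
    by rewrite gout//= in_itv/= andbT => tx; apply: nx; rewrite tx xt.
have : (\int[leb]_(x in `]t1, +oo[) ((c ^+ 2)%:E * (g x)%:E) <= E0%:E)%E.
  apply: le_trans energy_integral.
  apply: ge0_le_integral_nonmeasurable.
  - by move=> x _; rewrite -EFinM lee_fin mulr_ge0// ltW.
  - move=> x; rewrite /= in_itv/= andbT => tx.
    by rewrite lee_fin mulr_ge0 ?sqr_ge0 ?theta0.
  - move=> x; rewrite /= !in_itv/= !andbT => tx tx'; rewrite -EFinM lee_fin mulrC.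
    apply: ler_pM => //; first exact: ltW.
      by apply: gle; rewrite /= in_itv/= tx'.
    by rewrite ler_sqr ?nnegrE ?normr_ge0 ?(ltW c0)// rc// ltW.
  - by move=> x; rewrite /= !in_itv/= !andbT => tx []; exact: ltW (lt_trans t01 tx).
rewrite ge0_integralZl_EFin//; last 3 first.
- by move=> x _; rewrite lee_fin.
- exact: measurable_funTS mg'.
- exact: ltW.
by rewrite muleC -lee_pdivlMr.
Qed.

Lemma primitive_tail (e : R) : 0 < e ->
  exists2 t1, t0 < t1 & forall s t, t1 <= s -> s <= t -> G t - G s <= e.
Proof.
move=> e0; have Gsup : has_sup (range G).
  split; first by exists (G 0), 0.
  by exists C => _ [x _ <-]; have /andP[] := primitive_bounded x.
have [_ [x _ <-] lt] := sup_adherent e0 Gsup.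
exists (Num.max (t0 + 1) x); first by rewrite lt_max ltrDl ltr01.
move=> s t; rewrite ge_max => /andP[_ xs] st.
have : G t <= sup (range G) by apply: ub_le_sup; [case: Gsup|exists t].
have : G x <= G s by exact: primitive_nondecreasing.
lra.
Qed.

(** From a late time with residual below e / 2, [residual_growth] allows a further increase of at
    most 2 (e / 4). *)
Lemma residual_cvg : r t @[t --> +oo] --> (0 : R).
Proof.
apply/cvgrPdist_le => e e0.
have e4 : 0 < e / 4 by rewrite divr_gt0.
have [t1 t01 tail] := primitive_tail e4.
have e2 : 0 < e / 2 by rewrite divr_gt0.
have [t2 t12 rt2] := residual_small t01 e2.
exists t2; split; first exact: num_real.
move=> t /ltW t2t; rewrite sub0r normrN ger0_norm ?normr_ge0//.
have := residual_growth (le_trans (ltW t01) t12) t2t.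
have := tail _ _ t12 t2t; lra.
Qed.

End Energy.

Lemma nonincreasing_bounded_cvg (phi : R -> R) (b : R) :
  (forall s t, t0 <= s -> s <= t -> phi t <= phi s) ->
  (forall t, t0 <= t -> b <= phi t) -> cvg (phi t @[t --> +oo]).
Proof.
move=> mono lb; pose V := phi @` [set t | t0 <= t].
have Vinf : has_inf V.
  split; first by exists (phi t0), t0; rewrite //=.
  by exists b => _ [t tt <-]; exact: lb.
apply/cvg_ex; exists (inf V); apply/cvgrPdist_le => e e0.
have [_ [s ts <-] lt] := inf_adherent e0 Vinf.
exists s; split; first exact: num_real.
move=> t /ltW st; have := mono _ _ ts st.
have : inf V <= phi t.
  by apply: ge_inf; [case: Vinf|exists t => //=; exact: le_trans st].
move=> h1 h2; rewrite distrC ger0_norm ?subr_ge0//; lra.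
Qed.

(** Both |u - z| - G and - G are nonincreasing and bounded below from t0 on, so their difference
    converges. *)
Lemma distance_cvg z : T z = z -> cvg (`|u t - z| @[t --> +oo]).
Proof.
move=> Tz.
have c1 : cvg ((`|u t - z| - G t) @[t --> +oo]).
  apply: (@nonincreasing_bounded_cvg _ (- C)) => [s t ts st|t tt].
    by have := distance_growth Tz ts st; lra.
  by have := normr_ge0 (u t - z); have /andP[] := primitive_bounded t; lra.
have c2 : cvg (- G t @[t --> +oo]).
  apply: (@nonincreasing_bounded_cvg _ (- C)) => [s t ts st|t tt].
    by rewrite lerN2; exact: primitive_nondecreasing.
  by rewrite lerN2; have /andP[] := primitive_bounded t.
have -> : (fun t => `|u t - z|) = (fun t => (`|u t - z| - G t) - (- G t)).
  by apply/funext => t; rewrite opprK subrK.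
exact: is_cvgB.
Qed.

End Trajectory.

(** * Weak convergence *)

Section WeakConvergence.
Context {R : realType} {H : completeNormedModType R}.
Variables (dot : {dot H for idfun}) (hdot : induces_norm dot).

Let dE := dotE dot.

(** Compactness of [- M, M] gives a cluster point, and an ultrafilter converges to its cluster
    points. *)
Lemma ultra_cvg_bounded (X : Type) (U : set_system X) (UF : UltraFilter U)
    (v : X -> R) (M : R) : (\forall x \near U, `|v x| <= M) ->
  exists l : R, v x @[x --> U] --> l.
Proof.
move=> vM; have [|l [_ cl]] := @segment_compact R (- M) M (v @ U) _.
  by apply: filterS vM => x; rewrite /= in_itv/= -ler_norml.
exists l => B Bl; have [//|nB] := in_ultra_setVsetC (v @^-1` B) UF.
by have [y [nBy By]] := cl (~` B) B nB Bl.
Qed.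

(** The vector w minimises |y|^2 - 2 lam y: the first variation gives lam y <= <w, y>, and - y gives
    the converse. *)
Lemma riesz_representation (lam : H -> R) (M : R) :
  (forall x y, lam (x + y) = lam x + lam y) ->
  (forall a x, lam (a *: x) = a * lam x) ->
  (forall x, `|lam x| <= M * `|x|) -> exists w, forall y, lam y = dot w y.
Proof.
move=> lamD lamZ lamM.
pose q y := dot y y - 2 * lam y.
pose V := range q.
have Vlb : has_lbound V.
  exists (- M ^+ 2) => _ [y _ <-]; rewrite /q hdot.
  have := lamM y => /(le_trans (ler_norm _)) h.
  have := sqr_ge0 (M - `|y|); rewrite sqrrB; lra.
have V0 : V !=set0 by exists (q 0), 0.
set m := inf V.
have mle y : m <= q y by apply: ge_inf => //; exists y.
have [w hw] : exists w, forall e x, 0 < e -> q x < m + e -> `|x - w| ^+ 2 <= 4 * e.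
  apply: (@shrinking_sets_limit _ _ (fun e => [set x | q x < m + e]) 4).
  - by move=> e e0; have [_ [y _ <-] lt] := inf_adherent e0 (conj V0 Vlb); exists y.
  - by move=> e e' ee x /= /lt_le_trans; apply; rewrite lerD2l.
  - move=> e x y e0 /= qx qy; have := mle (2^-1 *: (x + y)).
    move: qx qy; rewrite -hdot /q lamZ lamD !dE (dotC dot y x); lra.
have half y : lam y <= dot w y.
  apply: (@le_of_small _ _ _ (2 * `|y| + (dot y y + 1) / 2)) => t t0 _.
  have t20 : 0 < t ^+ 2 by rewrite exprn_gt0.
  (* The tolerance t^2 puts x within 2 t of w, so using x for w in the variation costs only O(t). *)
  have [_ [x _ <-] qx] := inf_adherent t20 (conj V0 Vlb).
  have xw : `|x - w| <= 2 * t.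
    rewrite -ler_sqr ?nnegrE ?mulr_ge0 ?(ltW t0)// exprMn.
    by have := hw _ _ t20 qx; lra.
  have := dot_ge_small hdot (- y) xw; rewrite normrN.
  have := mle (x + t *: y); move: qx; rewrite -/m /q lamD lamZ !dE (dotC dot y x).
  move=> h1 h2 h3; rewrite -(ler_pM2l t0); nra.
exists w => y; apply/eqP; rewrite eq_le half /=.
by have := half (- y); rewrite -scaleN1r lamZ dE; lra.
Qed.

(** The limits of <v, y> along the ultrafilter form a bounded linear functional of y, which Riesz
    represents. *)
Lemma bounded_weak_limit (X : Type) (U : set_system X) (UF : UltraFilter U)
    (v : X -> H) (M : R) : (\forall x \near U, `|v x| <= M) ->
  exists w, forall y, dot (v x) y @[x --> U] --> dot w y.
Proof.
move=> vM.
have bd y : \forall x \near U, `|dot (v x) y| <= M * `|y|.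
  apply: filterS vM => x vx; apply: le_trans (cauchy_schwarz hdot _ _) _.
  by rewrite ler_wpM2r.
have /choice[lam hlam] : forall y, exists l : R, dot (v x) y @[x --> U] --> l.
  by move=> y; exact: ultra_cvg_bounded (bd y).
have uniq y l : dot (v x) y @[x --> U] --> l -> lam y = l.
  by move=> h; apply: cvg_unique (hlam y) h; exact: Rhausdorff.
have [||y|w hw] := @riesz_representation lam M.
- move=> x y; apply: uniq; under eq_fun do rewrite dotDr.
  exact: cvgD.
- move=> a x; apply: uniq; under eq_fun do rewrite dotZr.
  exact: cvgMr.
- exact: (cvgr_to_le (cvg_norm (hlam y)) (bd y)).
by exists w => y; rewrite -hw.
Qed.

(** Expanding |v - T w|^2 around w and comparing with (|T v - v| + |v - w|)^2 bounds |w - T w|^2 by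
    terms that vanish in the limit. *)
Lemma demiclosedness (X : Type) (U : set_system X) (UF : ProperFilter U)
    (T : H -> H) (v : X -> H) (w : H) (M : R) :
  (forall x y, `|T x - T y| <= `|x - y|) ->
  (\forall x \near U, `|v x| <= M) ->
  `|T (v x) - v x| @[x --> U] --> (0 : R) ->
  (forall y, dot (v x) y @[x --> U] --> dot w y) -> T w = w.
Proof.
move=> hT vM res weak.
have bound : \forall x \near U,
    `|w - T w| ^+ 2 + 2 * (dot (v x) (w - T w) - dot w (w - T w)) <=
    `|T (v x) - v x| ^+ 2 + 2 * (M + `|w|) * `|T (v x) - v x|.
  apply: filterS vM => x vx.
  have h1 : `|v x - w| <= M + `|w| by apply: le_trans (ler_normB _ _) _; rewrite lerD2r.
  have h2 : `|v x - T w| <= `|T (v x) - v x| + `|v x - w|.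
    by apply: le_trans (ler_distD (T (v x)) _ _) _; rewrite (distrC (v x)) lerD2l.
  have h3 : `|v x - T w| ^+ 2 = `|v x - w| ^+ 2 + `|w - T w| ^+ 2
      + 2 * (dot (v x) (w - T w) - dot w (w - T w)).
    have -> : v x - T w = (v x - w) + (w - T w) by rewrite addrA subrK.
    rewrite -!hdot !dE (dotC dot w (v x)) (dotC dot (T w) (v x)) (dotC dot (T w) w).
    by ring.
  have h4 : `|v x - T w| ^+ 2 <= (`|T (v x) - v x| + `|v x - w|) ^+ 2.
    by rewrite ler_sqr ?nnegrE ?addr_ge0.
  have := ler_wpM2l (normr_ge0 (T (v x) - v x)) h1.
  rewrite h3 sqrrD in h4; lra.
have lhs : `|w - T w| ^+ 2 + 2 * (dot (v x) (w - T w) - dot w (w - T w)) @[x --> U]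
    --> `|w - T w| ^+ 2 + 2 * (dot w (w - T w) - dot w (w - T w)).
  apply: cvgD; first exact: cvg_cst.
  by apply: cvgMr; apply: cvgB => //; exact: cvg_cst.
have rhs : `|T (v x) - v x| ^+ 2 + 2 * (M + `|w|) * `|T (v x) - v x| @[x --> U]
    --> (0 : R) ^+ 2 + 2 * (M + `|w|) * 0.
  by apply: cvgD; [exact: cvgM|exact: cvgMr].
have : `|w - T w| ^+ 2 + 2 * (dot w (w - T w) - dot w (w - T w))
    - ((0 : R) ^+ 2 + 2 * (M + `|w|) * 0) <= 0.
  apply: (cvgr_to_le (cvgB lhs rhs)).
  by apply: filterS bound => x; rewrite subr_le0.
rewrite subrr !mulr0 !addr0 expr0n/= subr0 => h.
have /eqP : `|w - T w| ^+ 2 = 0 by apply: le_anti; rewrite h exprn_ge0.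
by rewrite expf_eq0/= normr_eq0 subr_eq0 => /eqP.
Qed.

(* Weak cluster points along ultrafilters are fixed points by demiclosedness,
   and Opial's argument shows that there is only one. *)
Lemma opial_fixpoint (T : H -> H) (u : R -> H) (M : R) :
  (forall x y, `|T x - T y| <= `|x - y|) ->
  (\forall t \near +oo, `|u t| <= M) ->
  `|T (u t) - u t| @[t --> +oo] --> (0 : R) ->
  (forall z, T z = z -> cvg (`|u t - z| @[t --> +oo])) ->
  exists2 w, fixpoints T w & weakly_cvg_at_infty dot u w.
Proof.
move=> hT uM res dist.
have cluster (U : set_system R) : UltraFilter U -> pinfty_nbhs R `<=` U ->
    exists2 w, T w = w & forall y, dot (u t) y @[t --> U] --> dot w y.
  move=> UF sub; have [w hw] := bounded_weak_limit UF (sub _ uM); exists w => //.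
  by apply: (demiclosedness _ hT (sub _ uM)) hw => A /res /sub.
have uniq (U1 U2 : set_system R) w1 w2 : ProperFilter U1 -> ProperFilter U2 ->
    pinfty_nbhs R `<=` U1 -> pinfty_nbhs R `<=` U2 -> T w1 = w1 -> T w2 = w2 ->
    (forall y, dot (u t) y @[t --> U1] --> dot w1 y) ->
    (forall y, dot (u t) y @[t --> U2] --> dot w2 y) -> w1 = w2.
  move=> PU1 PU2 sub1 sub2 Tw1 Tw2 c1 c2.
  have /cvg_ex[l1 hl1] := dist _ Tw1; have /cvg_ex[l2 hl2] := dist _ Tw2.
  have [c hc] : exists c : R, dot (u t) (w1 - w2) @[t --> +oo] --> c.
    (* Polarisation: the inner product is a combination of |u - w1|^2 and |u - w2|^2, which converge
       along the whole trajectory, so both weak limits see the same c. *)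
    exists (2^-1 * (l2 ^+ 2 - l1 ^+ 2 + (`|w1| ^+ 2 - `|w2| ^+ 2))).
    have -> : (fun t => dot (u t) (w1 - w2)) =
        (fun t => 2^-1 * (`|u t - w2| ^+ 2 - `|u t - w1| ^+ 2 +
          (`|w1| ^+ 2 - `|w2| ^+ 2))).
      apply/funext => t; rewrite -!hdot !dE (dotC dot w1) (dotC dot w2).
      by field.
    apply: cvgMr; apply: cvgD; last exact: cvg_cst.
    by apply: cvgB; exact: cvgM.
  have e1 : dot w1 (w1 - w2) = c.
    by apply: (@cvg_unique _ (@Rhausdorff R) _ _ _ _ (c1 _)) => A /hc /sub1.
  have e2 : dot w2 (w1 - w2) = c.
    by apply: (@cvg_unique _ (@Rhausdorff R) _ _ _ _ (c2 _)) => A /hc /sub2.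
  have /eqP : `|w1 - w2| ^+ 2 = 0 by rewrite -hdot dotDl dotNl e1 e2 subrr.
  by rewrite expf_eq0/= normr_eq0 subr_eq0 => /eqP.
have [U [UF sub]] := @ultraFilterLemma _ (pinfty_nbhs R) _.
have [w Tw hw] := cluster U UF sub; exists w => // y.
apply/cvgrPdist_lt => e e0; apply: contrapT => far.
(* Failure of convergence makes the set B of bad times unbounded; an ultrafilter on B has a weak
   limit, which uniqueness identifies with w, against the definition of B. *)
pose B := [set t | ~ (`|dot w y - dot (u t) y| < e)].
have PB : ProperFilter (within B (pinfty_nbhs R)).
  split=> [h0|]; last exact: within_filter.
  apply: far.
  have {}h0 : \forall t \near +oo, B t -> False by exact: h0.
  by apply: filterS h0 => t ht; apply: contrapT => /ht.
have [U' [UF' sub']] := ultraFilterLemma PB.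
have sub2 : pinfty_nbhs R `<=` U'.
  by move=> A hA; apply: sub'; apply: filterS hA => t At _.
have [w' Tw' hw'] := cluster U' UF' sub2.
have ww' : w' = w := uniq _ _ _ _ _ _ sub2 sub Tw' Tw hw' hw; rewrite ww' in hw'.
have U'B : U' B by apply: sub'; exact: nearW.
have /cvgrPdist_lt /(_ e e0) U'e := hw' y.
by have [t [Bt]] := filter_ex (filterI U'B U'e).
Qed.

End WeakConvergence.

(** * Asymptotics of the Douglas-Rachford flow *)

Theorem theorem4p5 (R : realType) (H : completeNormedModType R)
    (dot : {dot H for idfun}) (hdot : induces_norm dot)
    (A B : H -> set H) (alpha beta gamma delta lambda mu : R)
    (hA : maximally_monotone dot alpha A)
    (hB : maximally_monotone dot beta B)
    (hab : 0 <= alpha + beta)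
    (hgamma : 0 < gamma) (hdelta : 0 < delta)
    (hlambda : 1 <= lambda) (hmu : 1 <= mu)
    (hga : 0 < 1 + 2 * gamma * alpha)
    (hmub : 2 - 2 * gamma * beta <= mu <= 2 + 2 * gamma * alpha)
    (hlm : (lambda - 1) * (mu - 1) = 1)
    (hdg : delta = (lambda - 1) * gamma)
    (hzer : zer (sum_op A B) !=set0)
    (t0 : R) (ht0 : 0 < t0)
    (theta : R -> R) (htheta0 : forall t, t0 <= t -> 0 <= theta t)
    (htheta : locally_integrable_from t0 theta)
    (hthetaoo :
      (\int[@lebesgue_measure R]_(s in `[t0, +oo[) (theta s)%:E = +oo)%E)
    (f : R -> H) (hf : bochner_integrable `[t0, +oo[ f)
    (T : H -> H)
    (hT : T = relaxed_resolvent delta B mu \o relaxed_resolvent gamma A lambda)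
    (u0 : H) (u : R -> H) (hu : strong_global_solution t0 theta f T u0 u) :
  [/\ (\int[@lebesgue_measure R]_(s in `[t0, +oo[)
          (theta s * `|T (u s) - u s| ^+ 2)%:E < +oo)%E,
      `|T (u t) - u t| @[t --> +oo] --> (0 : R)
    & exists2 uhat : H, fixpoints T uhat & weakly_cvg_at_infty dot u uhat].
Proof.
have T1 x y : `|T x - T y| <= `|x - y|.
  by rewrite hT; exact: (DR_nonexpansive hdot hA hB hgamma hdelta hmu hga hmub hlm hdg).
have [z Tz] : fixpoints T !=set0.
  by rewrite hT; exact: (DR_fixpoint hdot hA hB hgamma hdelta hga hmub hlm hdg).
have [uac ode _] := hu.
have [F [mF F0 iF fF]] := bochner_integrable_majorant (measurable_itv _) hf.
have {}fF : {ae @lebesgue_measure R, forall t, t0 <= t -> `|f t| <= F t}.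
  move: fF; apply: filterS; first exact: (ae_filter_ringOfSetsType lebesgue_measure).
  by move=> t ft tt; apply: ft; rewrite /= in_itv/= tt.
have res := residual_cvg hdot T1 htheta0 uac ode mF F0 iF fF Tz htheta hthetaoo.
split => //.
  by apply: le_lt_trans (energy_integral hdot T1 htheta0 uac ode mF F0 iF fF Tz) (ltry _).
apply: (opial_fixpoint hdot T1 _ res).
  exists t0; split; first exact: num_real.
  move=> t /ltW tt; have := trajectory_bounded T1 htheta0 uac ode mF F0 iF fF Tz tt.
  move=> h; rewrite -[u t](subrK z); apply: le_trans (ler_normD _ _) _.
  exact: lerD h (lexx _).
by move=> y Ty; exact: (distance_cvg T1 htheta0 uac ode mF F0 iF fF Ty).
Qed.
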